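(* Let $B_1,\dots,B_k$ be graphons, let $\alpha_1,\dots,\alpha_k\ge0$ with $\sum_{i=1}^k\alpha_i=1$, and let $f=f(\{\alpha_i\},\{B_i\})=\sum_{i=1}^k\alpha_iB_i$ be the corresponding graph generator. Let $n\ge1$, let $\mathbb G=\mathbb G(n,f)$ be the random graph with $n$ nodes generated from $f$, and let $F$ be a graph motif. Then for every $0\le\varepsilon\le1$, $$\mathrm P\big(|t(F,\mathbb G)-t(F,f)|>\varepsilon\big)\;\le\;2\exp\!\left(-\frac{\varepsilon^2n}{8\,\mathrm v(F)^2}\right),$$ where $\mathrm v(F)$ denotes the number of nodes of $F$.
   Context: A graphon is a measurable symmetric function $B:[0,1]^2\to[0,1]$; the generator $f$ is regarded as a graphon. The random graph $\mathbb G(n,f)$ is generated as follows: sample $v_1,\dots,v_n$ independently and uniformly from $[0,1]$; conditionally on these, for each pair $i<j$ in $\{1,\dots,n\}$ independently put an edge between $i$ and $j$ with probability $f(v_i,v_j)$ (the graph is simple and undirected). A graph motif is a finite simple graph $F=(V',E')$ (with at least one node). For a finite graph $G=(V,E)$, the homomorphism density $t(F,G)=\hom(F,G)/|V|^{|V'|}$, where $\hom(F,G)$ is the number of adjacency-preserving maps $V'\to V$ (i.e. $\{i,j\}\in E'$ implies that the image pair is in $E$). For a graphon $B$, $t(F,B)=\int_{[0,1]^{V'}}\prod_{\{u,v\}\in E'}B(x_u,x_v)\prod_{v\in V'}dx_v$. *)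

(* Defs.v *)
From HB Require Import structures.
From mathcomp Require Import all_boot all_order all_algebra.
From mathcomp Require Import all_classical all_reals all_analysis measurable_realfun.

Set Implicit Arguments.
Unset Strict Implicit.
Unset Printing Implicit Defensive.

Import Order.TTheory GRing.Theory Num.Theory.
Import numFieldNormedType.Exports.

Local Open Scope classical_set_scope.
Local Open Scope ring_scope.

Definition simple_adjacency (T : finType) (e : {ffun T * T -> bool}) : bool :=
  [forall x, ~~ e (x, x)] && [forall x, [forall y, e (x, y) == e (y, x)]].

Record sgraph (T : finType) := SGraph {
  sgraph_ffun : {ffun T * T -> bool} ;
  sgraph_simple : simple_adjacency sgraph_ffun }.

HB.instance Definition _ (T : finType) :=
  [isSub of sgraph T for @sgraph_ffun T].
HB.instance Definition _ (T : finType) := [Finite of sgraph T by <:].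

Definition adj (T : finType) (G : sgraph T) : rel T :=
  fun x y => sgraph_ffun G (x, y).
Coercion adj : sgraph >-> rel.

Lemma adj_irr (T : finType) (G : sgraph T) : irreflexive G.
Proof.
case: G => e se x; have /andP[/forallP ei _] := se.
by rewrite /adj/=; exact/negbTE/ei.
Qed.

Lemma adj_sym (T : finType) (G : sgraph T) : symmetric G.
Proof.
case: G => e se x y; have /andP[_ /forallP es] := se.
by have /forallP/(_ y)/eqP := es x.
Qed.

Lemma sgraph_eqP (T : finType) (G H : sgraph T) :
  (forall x y, G x y = H x y) -> G = H.
Proof. by move=> GH; apply/val_inj/ffunP => -[x y]; exact: GH. Qed.

Section sgraph_measurable.
Variable T : finType.

Let empty_subproof : simple_adjacency ([ffun=> false] : {ffun T * T -> bool}).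
Proof.
apply/andP; split; apply/forallP => x; first by rewrite ffunE.
by apply/forallP => y; rewrite !ffunE.
Qed.

HB.instance Definition _ := isPointed.Build (sgraph T) (SGraph empty_subproof).
HB.instance Definition _ := @isMeasurable.Build default_measure_display
  (sgraph T) discrete_measurable discrete_measurable0
  discrete_measurableC discrete_measurableU.

End sgraph_measurable.

Definition homs (V W : finType) (F : sgraph V) (G : sgraph W) :
    {set {ffun V -> W}} :=
  [set phi : {ffun V -> W} |
    [forall u, [forall v, F u v ==> G (phi u) (phi v)]]]%SET.

Definition hom_density (R : realType) (V W : finType)
    (F : sgraph V) (G : sgraph W) : R :=
  #|homs F G|%:R / #|W|%:R ^+ #|V|.

Section uniform_tuple.
Variable R : realType.

Let idTR : measurableTypeR R -> R := idfun.

#[local] HB.instance Definition _ :=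
  @isMeasurableFun.Build _ _ _ _ idTR (@measurable_id _ _ setT).

(* The library's uniform probability lives on measurableTypeR R, whose
   sigma-algebra is that of R but with another display. *)
Definition uniform01 : probability R R :=
  distribution (uniform_prob (@ltr01 R)) idTR.

Lemma uniform01E (A : set R) : uniform01 A = uniform_prob (@ltr01 R) A.
Proof. by []. Qed.

Definition tcons n (z : R * n.-tuple R) : n.+1.-tuple R :=
  [tuple of z.1 :: z.2].

Lemma measurable_tcons n : measurable_fun [set: R * n.-tuple R] (@tcons n).
Proof. exact: measurable_cons. Qed.

HB.instance Definition _ n :=
  isMeasurableFun.Build _ _ _ _ (@tcons n) (@measurable_tcons n).

(* The n-fold product of uniform01, that is, the n-dimensional Lebesgue measure
   carried by the cube [0, 1]^n; see uniform_tuple_box. *)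
Fixpoint uniform_tuple n : probability (n.-tuple R) R :=
  if n is m.+1 then distribution (uniform01 \x uniform_tuple m)%E (@tcons m)
  else \d_[tuple].

Lemma measurable_box n (A : 'I_n -> set R) : (forall i, measurable (A i)) ->
  measurable [set v : n.-tuple R | forall i, A i (tnth v i)].
Proof.
move=> mA.
rewrite (_ : mkset _ = \bigcap_(i in [set: 'I_n]) ((@tnth n R ^~ i) @^-1` A i)).
  apply: fin_bigcap_measurable => // i _; rewrite -[X in measurable X]setTI.
  exact: measurable_tnth.
by apply/seteqP; split=> [v /= h i _|v /= h i]; exact: h.
Qed.

Lemma uniform_tuple_box n (A : 'I_n -> set R) : (forall i, measurable (A i)) ->
  uniform_tuple n [set v | forall i, A i (tnth v i)] =
  (\prod_(i < n) uniform01 (A i))%E.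
Proof.
elim: n A => [|n IH] A mA.
  by rewrite big_ord0 /= diracE mem_set//= => -[].
have mA' i : measurable ((A \o lift ord0) i) by exact: mA.
rewrite big_ord_recl -(IH (A \o lift ord0))//.
rewrite -product_measure1E//; last exact: measurable_box.
rewrite /= {1}/distribution /pushforward.
congr (product_measure1 _ _ _).
apply/seteqP; split=> [[x v]/= h|[x v]/= [h0 h] i].
  split=> [|i]; first exact: (h ord0).
  by have := h (lift ord0 i); rewrite tnthS.
by case: (unliftP ord0 i) => [j|] ->; rewrite ?tnthS//; exact: h.
Qed.

Definition unit_cube n : set (n.-tuple R) :=
  [set v | forall i, tnth v i \in `[0, 1]].
Arguments unit_cube : clear implicits.

Lemma measurable_unit_cube n : measurable (unit_cube n).
Proof.
exact: (@measurable_box n (fun=> [set` `[0, 1]%R])).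
Qed.

Lemma uniform_tuple_cube n : uniform_tuple n (unit_cube n) = 1%E.
Proof.
rewrite (@uniform_tuple_box n (fun=> [set` `[0, 1]%R]))// big1// => i _.
by rewrite uniform01E /uniform_prob integral_uniform_pdf1.
Qed.

End uniform_tuple.
Arguments uniform_tuple : clear implicits.
Arguments unit_cube : clear implicits.

Definition unit_square (R : realType) : set (R * R) := `[0, 1] `*` `[0, 1].
Arguments unit_square : clear implicits.

(* Only the values on [0, 1]^2 are constrained; everything below integrates over
   unit cubes, so the values elsewhere are irrelevant. *)
Record graphon (R : realType) := Graphon {
  gfun :> R -> R -> R ;
  measurable_gfun :
    measurable_fun (unit_square R) (fun z : R * R => gfun z.1 z.2) ;
  gfun_sym : {in `[0, 1] &, forall x y, gfun x y = gfun y x} ;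
  gfun01 : {in `[0, 1] &, forall x y, 0 <= gfun x y <= 1} }.

Section graphon_density.
Variables (R : realType) (V : finType) (F : sgraph V) (B : graphon R).

(* Each edge {u, v} is counted once, through its orientation that is
   increasing for the enumeration of V. *)
Definition graphon_density : R :=
  (\int[uniform_tuple R #|V|]_(x in unit_cube R #|V|)
     \prod_(e : V * V | F e.1 e.2 && (enum_rank e.1 < enum_rank e.2)%N)
       B (tnth x (enum_rank e.1)) (tnth x (enum_rank e.2)))%R.
End graphon_density.

Section random_graph.
Variables (R : realType) (n : nat) (f : graphon R).

(* Conditional probability of the graph g given the labels v of the nodes: the
   pairs i < j carry independent Bernoulli variables, the one at i < j being true
   with probability f (v_i, v_j). *)
Definition edge_pmf (v : n.-tuple R) (g : sgraph 'I_n) : R :=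
  \prod_(e : 'I_n * 'I_n | (e.1 < e.2)%N)
     bernoulli_pmf (f (tnth v e.1) (tnth v e.2)) (g e.1 e.2).

(* The law of the random graph, as a probability on graphs on 'I_n: integrate the
   conditional law over independent uniform labels. *)
Definition random_graph (A : set (sgraph 'I_n)) : \bar R :=
  (\int[uniform_tuple R n]_(v in unit_cube R n)
     (\sum_(g | g \in A) edge_pmf v g)%:E)%E.

Let edge_pmf_ge0 v g : unit_cube R n v -> 0 <= edge_pmf v g.
Proof.
move=> cv; apply: prodr_ge0 => e _; apply: bernoulli_pmf_ge0.
by apply: gfun01; exact: cv.
Qed.

Let sum_edge_pmf v : \sum_g edge_pmf v g = 1.
Proof.
pose P (e : 'I_n * 'I_n) := (e.1 < e.2)%N.
pose p (e : 'I_n * 'I_n) := bernoulli_pmf (f (tnth v e.1) (tnth v e.2)).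
pose half (g : sgraph 'I_n) : {ffun 'I_n * 'I_n -> bool} :=
  [ffun e => P e && g e.1 e.2].
pose sym (h : {ffun 'I_n * 'I_n -> bool}) : {ffun 'I_n * 'I_n -> bool} :=
  [ffun e => (P e && h e) || (P (e.2, e.1) && h (e.2, e.1))].
have symP h : simple_adjacency (sym h).
  apply/andP; split; apply/forallP => x; first by rewrite ffunE /P/= ltnn.
  by apply/forallP => y; rewrite !ffunE/= orbC.
have -> : 1 = \prod_(e | P e) \sum_(b | predT b) p e b.
  by rewrite big1// => e _; rewrite big_bool/= /p/= subrKC.
rewrite (big_distr_big_dep false)/=.
rewrite (reindex_onto half (fun h => SGraph (symP h)))/=; last first.
  move=> h /pfamilyP[/fintype.subsetP hP _]; apply/ffunP => -[i j].
  rewrite !ffunE/= /adj/= ffunE/= /P/=.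
  case: ltngtP => //= ij; rewrite ?orbF//.
  - apply/esym/negbTE/negP => hij.
    have : (i, j) \in P by apply: hP; rewrite inE/= hij.
    by rewrite unfold_in /P/= ltnNge (ltnW ij).
  - apply/esym/negbTE/negP => hij.
    have : (i, j) \in P by apply: hP; rewrite inE/= hij.
    by rewrite unfold_in /P/= ij ltnn.
apply: eq_big => g.
  apply/esym/andP; split.
    apply/pfamilyP; split; last by [].
    apply/fintype.subsetP => e.
    by rewrite inE ffunE eqbF_neg negbK => /andP[].
  apply/eqP/sgraph_eqP => i j; rewrite /adj/= !ffunE/= /P/=.
  case: ltngtP => //= ij; rewrite ?orbF// -/(adj g _ _).
  - exact: adj_sym.
  - by rewrite (_ : i = j) ?adj_irr//; exact/val_inj.
by move=> _; apply: eq_bigr => e Pe; rewrite ffunE /P Pe.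
Qed.

Let measurable_edge_pmf g : measurable_fun (unit_cube R n) (edge_pmf ^~ g).
Proof.
rewrite (_ : edge_pmf ^~ g = fun v => \prod_(e : 'I_n * 'I_n) if (e.1 < e.2)%N then
    bernoulli_pmf (f (tnth v e.1) (tnth v e.2)) (g e.1 e.2) else 1); last first.
  by apply/funext => v; rewrite /edge_pmf big_mkcond.
apply: measurable_prod => -[i j] _ /=; case: (i < j)%N => //.
have mf : measurable_fun (unit_cube R n) (fun v => f (tnth v i) (tnth v j)).
  apply: (@measurable_comp _ _ _ _ _ _ (unit_square R)
    (fun z : R * R => f z.1 z.2) (unit_cube R n)
    (fun v => (tnth v i, tnth v j))).
  - exact: measurableX.
  - by move=> _ [v cv <-]; split; exact: cv.
  - exact: measurable_gfun.
  - by apply: measurable_funTS; apply: measurable_fun_pair; exact: measurable_tnth.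
by rewrite /bernoulli_pmf; case: (g i j) => //; exact: measurable_funB.
Qed.

Let mass g : \bar R :=
  (\int[uniform_tuple R n]_(v in unit_cube R n) (edge_pmf v g)%:E)%E.

Let mass_ge0 g : (0 <= mass g)%E.
Proof. by apply: integral_ge0 => v cv; rewrite lee_fin edge_pmf_ge0. Qed.

Let mass_fin g : mass g \is a fin_num.
Proof.
rewrite ge0_fin_numE//; apply: (@le_lt_trans _ _ 1%E); last exact: ltry.
rewrite -(uniform_tuple_cube R n) -[leRHS]mul1e.
rewrite -integral_cst; last exact: measurable_unit_cube.
apply: ge0_le_integral => //.
- exact: measurable_unit_cube.
- by move=> v cv; rewrite lee_fin edge_pmf_ge0.
- exact/measurable_EFinP.
- move=> v cv; rewrite lee_fin -(sum_edge_pmf v) (bigD1 g)//= lerDl.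
  by apply: sumr_ge0 => h _; exact: edge_pmf_ge0.
Qed.

Let random_graph_mass A : random_graph A = (\sum_g mass g * \d_g A)%E.
Proof.
rewrite /random_graph.
under eq_integral do rewrite big_mkcond/= -sumEFin.
rewrite ge0_integral_sum//; first last.
- by move=> g v cv; case: ifP => // _; rewrite lee_fin edge_pmf_ge0.
- by move=> g; case: (g \in A) => //; exact/measurable_EFinP.
- exact: measurable_unit_cube.
apply: eq_bigr => g _; rewrite diracE; case: (g \in A); rewrite ?mule1//.
by rewrite integral0 mule0.
Qed.

Let random_graph0 : random_graph set0 = 0%E.
Proof.
by rewrite random_graph_mass big1// => g _; rewrite dirac0 mule0.
Qed.

Let random_graph_ge0 A : (0 <= random_graph A)%E.
Proof.
by rewrite random_graph_mass; apply: sume_ge0 => g _; exact: mule_ge0.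
Qed.

Let random_graph_sigma_additive : semi_sigma_additive random_graph.
Proof.
move=> F mF tF mUF; rewrite random_graph_mass.
rewrite (_ : (fun _ => _) = (fun m =>
    \sum_(g : sgraph 'I_n) mass g * \sum_(0 <= i < m) \d_g (F i))%E); last first.
  apply/funext => m; under eq_bigr do rewrite random_graph_mass.
  rewrite exchange_big/=; apply: eq_bigr => g _.
  by rewrite ge0_sume_distrr.
apply: cvg_nnesum => g _.
  by near=> m; apply: mule_ge0 => //; exact: sume_ge0.
by apply: cvgeZl; [exact: mass_fin|exact: measure_semi_sigma_additive].
Unshelve. all: by end_near. Qed.

HB.instance Definition _ := isMeasure.Build _ _ _ random_graph
  random_graph0 random_graph_ge0 random_graph_sigma_additive.

Let random_graphT : random_graph setT = 1%E.
Proof.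
rewrite /random_graph (eq_integral (cst 1%E)); last first.
  move=> v _; rewrite (eq_bigl predT) ?sum_edge_pmf// => g.
  by rewrite in_setT.
rewrite integral_cst ?mul1e; first exact: uniform_tuple_cube.
exact: measurable_unit_cube.
Qed.

HB.instance Definition _ :=
  Measure_isProbability.Build _ _ _ random_graph random_graphT.

End random_graph.
Arguments random_graph {R} n f A.

Section generator.
Variables (R : realType) (k : nat) (alpha : 'I_k -> R) (B : 'I_k -> graphon R).
Hypothesis alpha_ge0 : forall i, 0 <= alpha i.
Hypothesis alpha_sum : \sum_(i < k) alpha i = 1.

Definition generator_fun (x y : R) : R := \sum_(i < k) alpha i * B i x y.

Let mgen :
  measurable_fun (unit_square R) (fun z : R * R => generator_fun z.1 z.2).
Proof.
apply: measurable_sum => i; apply: measurable_funM => //.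
exact: measurable_gfun.
Qed.

Let sgen : {in `[0, 1] &, forall x y, generator_fun x y = generator_fun y x}.
Proof. by move=> x y hx hy; apply: eq_bigr => i _; rewrite gfun_sym. Qed.

Let gen01 : {in `[0, 1] &, forall x y, 0 <= generator_fun x y <= 1}.
Proof.
move=> x y hx hy; apply/andP; split.
  apply: sumr_ge0 => i _; apply: mulr_ge0 => //.
  by have /andP[] := gfun01 (B i) hx hy.
rewrite -alpha_sum; apply: ler_sum => i _; apply: ler_piMr => //.
by have /andP[] := gfun01 (B i) hx hy.
Qed.

Definition generator : graphon R := Graphon mgen sgen gen01.

End generator.

(* Main.v *)
(* Write k for the number of nodes of F and t for its density in f. If
   eps * n < k^2 the bound exceeds 1. Otherwise the homomorphism density differs
   by at most k^2 / (2 n) <= eps / 2 from the density Y of injective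
   homomorphisms. Following Hoeffding's treatment of U-statistics, Y is the
   average, over all permutations p of the nodes, of the mean of the m = n / k
   indicators that p maps the j-th block of k nodes onto a copy of F. For a fixed
   p the blocks are disjoint, so these indicators are independent Bernoulli
   variables of parameter t, and convexity of exp bounds the moment generating
   function of Y - t by that of the mean of m independent variables. Chernoff's
   bound with exponent l = +- eps / 2 per block gives exp (- m eps^2 / 8) on each
   side, and m k^2 >= n. *)
From HB Require Import structures.
Require Import Defs.
From mathcomp Require Import all_boot all_order all_algebra.
From mathcomp Require Import perm.
From mathcomp Require Import all_classical all_reals all_analysis.
From mathcomp Require Import ring lra zify measurable_realfun.

Set Implicit Arguments.
Unset Strict Implicit.
Unset Printing Implicit Defensive.

Import Order.TTheory GRing.Theory Num.Theory.
Import numFieldNormedType.Exports.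
Local Open Scope classical_set_scope.
Local Open Scope ring_scope.

(** * Sums over simple graphs and inclusion probabilities *)

Lemma sum_sgraph_prod (R : comNzRingType) (n : nat)
    (w : 'I_n * 'I_n -> bool -> R) :
  \sum_(g : sgraph 'I_n) \prod_(e : 'I_n * 'I_n | (e.1 < e.2)%N)
     w e (g e.1 e.2) =
  \prod_(e : 'I_n * 'I_n | (e.1 < e.2)%N) (w e true + w e false).
Proof.
(* A simple graph amounts to an arbitrary Boolean function on the pairs i < j: [up] extracts it and
   [sym] rebuilds the graph, so the claim is distributivity of the product over the sums. *)
pose P (e : 'I_n * 'I_n) := (e.1 < e.2)%N.
pose up (g : sgraph 'I_n) : {ffun 'I_n * 'I_n -> bool} :=
  [ffun e => P e && g e.1 e.2].
pose sym (h : {ffun 'I_n * 'I_n -> bool}) : {ffun 'I_n * 'I_n -> bool} :=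
  [ffun e => P e && h e || P (e.2, e.1) && h (e.2, e.1)].
have symP h : simple_adjacency (sym h).
  apply/andP; split; apply/forallP => x; first by rewrite ffunE /P/= ltnn.
  by apply/forallP => y; rewrite !ffunE/= orbC.
transitivity (\prod_(e | P e) \sum_(b | predT b) w e b); last first.
  by apply: eq_bigr => e _; rewrite big_bool.
rewrite (big_distr_big_dep false)/= (reindex_onto up (fun h => SGraph (symP h))).
  apply: eq_big => [g|g _]; last by apply: eq_bigr => e Pe; rewrite ffunE /P Pe.
  apply/esym/andP; split.
    apply/pfamilyP; split=> //; apply/fintype.subsetP => e.
    by rewrite inE ffunE eqbF_neg negbK => /andP[].
  apply/eqP/sgraph_eqP => i j; rewrite /adj/= !ffunE/= /P/=.
  case: ltngtP => //= ij; rewrite ?orbF// -/(adj g _ _); first exact: adj_sym.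
  by rewrite (_ : i = j) ?adj_irr//; exact/val_inj.
move=> h /pfamilyP[/fintype.subsetP hP _]; apply/ffunP => -[i j].
rewrite !ffunE/= /adj/= ffunE/=.
case Pij : (P (i, j)); last first.
  apply/esym/negbTE/negP => hij; have := hP (i, j).
  by rewrite inE hij => /(_ isT) /idP; rewrite -[_ \in _]/(P (i, j)) Pij.
by rewrite (_ : P (j, i) = false) ?orbF// /P ltnNge (ltnW Pij).
Qed.

Section inclusion_probability.
Variables (R : realType) (n : nat) (f : graphon R) (v : n.-tuple R).
Hypothesis cv : unit_cube R n v.

Lemma edge_pmf_ge0 g : 0 <= edge_pmf f v g.
Proof.
by apply: prodr_ge0 => e _; apply: bernoulli_pmf_ge0; apply: gfun01; apply: cv.
Qed.

(** Distinct unordered pairs carry independent coins. Absorb the indicators of the prescribed edges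
    into the weights of [sum_sgraph_prod]: a prescribed pair then contributes its value of [f], any
    other pair contributes 1. *)
Lemma sum_edge_pmf_subgraph (I : finType) (P : pred I) (a b : I -> 'I_n) :
    {in P, forall i, a i != b i} ->
    {in P &, forall i j, [\/ (a i, b i) = (a j, b j) | (a i, b i) = (b j, a j)] ->
      i = j} ->
  \sum_g edge_pmf f v g * \prod_(i | P i) (g (a i) (b i))%:R =
  \prod_(i | P i) f (tnth v (a i)) (tnth v (b i)).
Proof.
move=> abN abI.
(* The increasing orientation matches the indexing of [edge_pmf]; distinctness of the unordered
   pairs becomes injectivity of [e]. *)
pose e i := if (a i < b i)%N then (a i, b i) else (b i, a i).
have eI : {in P &, injective e}.
  move=> i j Pi Pj; rewrite /e; case: ifP => _; case: ifP => _ [h1 h2];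
    apply: abI => //; rewrite h1 h2; first [by left|by right].
have eP i : P i -> ((e i).1 < (e i).2)%N.
  move=> Pi; rewrite /e; have := abN i Pi; rewrite -val_eqE/=.
  by case: ifP => //= ba; rewrite ltn_neqAle eq_sym => ->; rewrite leqNgt ba.
have prodE (F : 'I_n * 'I_n -> R) : \prod_(i | P i) F (e i) =
    \prod_(x : 'I_n * 'I_n | (x.1 < x.2)%N) if x \in e @: P then F x else 1.
  rewrite -big_mkcondr/= -(big_imset F eI)/=; apply: eq_bigl => x.
  apply/idP/andP => [xe|[]//]; split=> //.
  by have /imsetP[i Pi ->] := xe; apply: eP.
have -> : \prod_(i | P i) f (tnth v (a i)) (tnth v (b i)) =
    \prod_(i | P i) f (tnth v (e i).1) (tnth v (e i).2).
  apply: eq_bigr => i _; rewrite /e; case: ifP => // _; apply: gfun_sym; exact: cv.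
rewrite (prodE (fun x => f (tnth v x.1) (tnth v x.2))).
transitivity (\sum_(g : sgraph 'I_n) \prod_(x : 'I_n * 'I_n | (x.1 < x.2)%N)
   (bernoulli_pmf (f (tnth v x.1) (tnth v x.2)) (g x.1 x.2) *
    if x \in e @: P then (g x.1 x.2)%:R else 1)).
  apply: eq_bigr => g _; rewrite big_split/= -(prodE (fun x => (g x.1 x.2)%:R)).
  congr (_ * _); apply: eq_bigr => i _; rewrite /e; case: ifP => //= _.
  by rewrite adj_sym.
rewrite (sum_sgraph_prod (fun x t => bernoulli_pmf (f (tnth v x.1) (tnth v x.2)) t *
    if x \in e @: P then t%:R else 1)).
apply: eq_bigr => x _; rewrite /bernoulli_pmf/=.
by case: ifP => _; rewrite ?mulr1 ?mulr0 ?addr0 ?subrKC.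
Qed.

End inclusion_probability.

(** * The uniform measure on tuples: selection of coordinates and independence *)

Section uniform_tuple_theory.
Variable R : realType.
Local Notation mu := (uniform_tuple R).
Local Open Scope ereal_scope.

Definition select (m n : nat) (s : 'I_m -> 'I_n) (v : n.-tuple R) : m.-tuple R :=
  [tuple tnth v (s i) | i < m].

Lemma measurable_select (m n : nat) (s : 'I_m -> 'I_n) :
  measurable_fun setT (@select m n s).
Proof.
apply/measurable_fun_tnthP => i.
rewrite (_ : _ \o _ = @tnth n R ^~ (s i)); first exact: measurable_tnth.
by apply/funext => v /=; rewrite tnth_mktuple.
Qed.

Let box n (A : 'I_n -> set R) : set (n.-tuple R) :=
  [set v | forall i, A i (tnth v i)].

(** Unlike one-coordinate cylinders, boxes are stable under intersection, as the uniqueness theorem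
    for measures requires of a generating family. *)
Lemma measurable_tupleE n : @measurable _ (n.-tuple R) =
  <<s [set X | exists2 A : 'I_n -> set R,
      (forall i, measurable (A i)) & X = box A] >>.
Proof.
apply/seteqP; split.
  apply: smallest_sub; first exact: smallest_sigma_algebra.
  move=> X; rewrite -bigcup_seq => -[i _ [Y mY <-]]; apply: sub_sigma_algebra.
  exists (fun j => if j == i then Y else setT).
    by move=> j; case: ifP.
  rewrite setTI; apply/seteqP; split=> v /= h.
    by move=> j; case: eqP => [->|].
  by have := h i; rewrite eqxx.
apply: smallest_sub; first exact: sigma_algebra_measurable.
by move=> X [A mA ->]; exact: measurable_box.
Qed.

Lemma uniform_tuple_unique n (P : {measure set (n.-tuple R) -> \bar R}) :
    (forall A : 'I_n -> set R, (forall i, measurable (A i)) ->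
      P [set v | forall i, A i (tnth v i)] = \prod_(i < n) uniform01 R (A i)) ->
  forall X, measurable X -> P X = mu n X.
Proof.
move=> PE X mX.
have boxT : [set: n.-tuple R] = box (fun=> setT) by apply/seteqP; split.
apply: (measure_unique _ (fun=> setT) (measurable_tupleE n)) => //.
- move=> _ _ [A mA ->] [B mB ->]; exists (fun i => A i `&` B i).
    by move=> i; exact: measurableI.
  apply/seteqP; split=> [v [hA hB] i|v h]; first by split.
  by split=> i; case: (h i).
- by move=> _; exists (fun=> setT).
- by rewrite bigcup_const//; exists 0%N.
- by move=> _ [A mA ->]; rewrite PE//; exact/esym/uniform_tuple_box.
- move=> _; rewrite boxT PE// big1 ?ltry// => i _; exact: probability_setT.
Qed.

(** Coordinates picked without repetition are again independent and uniform: by uniqueness it is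
    enough to test boxes, and the preimage of a box is a box. *)
Lemma uniform_tuple_select m n (s : 'I_m -> 'I_n) (X : set (m.-tuple R)) :
  injective s -> measurable X -> pushforward (mu n) (select s) X = mu m X.
Proof.
move=> sI mX.
pose sm := isMeasurableFun.Build _ _ _ _ _ (measurable_select s).
pose sM : {mfun _ >-> _} := HB.pack (select s) sm.
apply: (@uniform_tuple_unique m (pushforward (mu n) sM)) => // A mA.
(* By injectivity this is [A i] at j = s i; off the range of [s] it is an empty intersection, hence
   everything, of mass 1. *)
pose A' (j : 'I_n) := \bigcap_(i in [set i | s i = j]) A i.
have mA' j : measurable (A' j) by apply: fin_bigcap_measurable.
transitivity (mu n [set v | forall j, A' j (tnth v j)]).
  rewrite /pushforward/=; congr (mu n _); apply/seteqP; split=> v /= h.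
    by move=> j i /= <-; have := h i; rewrite tnth_mktuple.
  by move=> i; rewrite tnth_mktuple; exact: (h (s i)).
rewrite uniform_tuple_box// (bigID (fun j => j \in s @: 'I_m))/=.
rewrite [X in _ * X]big1 ?mule1; last first.
  move=> j js; rewrite (_ : A' j = setT) ?probability_setT//.
  apply/seteqP; split=> // x _ i /= ij; move: js; rewrite -ij imset_f//.
rewrite big_imset/=; last by move=> ? ? _ _; exact: sI.
apply: eq_bigr => i _; congr (uniform01 R _); apply/seteqP; split=> x /=.
  by apply.
by move=> Ax j /= /sI ->.
Qed.

Lemma integral_select m n (s : 'I_m -> 'I_n) (g : m.-tuple R -> \bar R) :
    injective s -> measurable_fun setT g -> (forall v, 0 <= g v) ->
  \int[mu n]_v g (select s v) = \int[mu m]_v g v.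
Proof.
move=> sI mg g0.
rewrite -(ge0_integral_pushforward (measurable_select s) (mu n) measurableT)//.
apply: eq_measure_integral => [|? A mA _]; first exact: measurable_select.
exact: (uniform_tuple_select sI mA).
Qed.

End uniform_tuple_theory.

Lemma integral_probability_cst d (T : measurableType d) (R : realType)
    (P : probability T R) (c : \bar R) : (\int[P]_x c = c)%E.
Proof.
by rewrite integral_cst// -[RHS]mule1; congr (_ * _)%E; exact: probability_setT.
Qed.

Section uniform_tuple_independence.
Variable R : realType.
Local Notation mu := (uniform_tuple R).
Local Open Scope ereal_scope.

Definition depends_on (U : Type) n (S : pred 'I_n) (g : n.-tuple R -> U) :=
  forall v w, (forall i, S i -> tnth v i = tnth w i) -> g v = g w.

Lemma integral_tcons n (g : n.+1.-tuple R -> \bar R) :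
    measurable_fun setT g -> (forall v, 0 <= g v) ->
  \int[mu n.+1]_v g v = \int[uniform01 R]_x \int[mu n]_v g (tcons (x, v)).
Proof.
move=> mg g0.
rewrite [mu _]/= (ge0_integral_pushforward (@measurable_tcons R n))//=.
rewrite fubini_tonelli1//=.
by apply: measurableT_comp => //; exact: measurable_tcons.
Qed.

Lemma measurable_tcons_section n (g : n.+1.-tuple R -> \bar R) x :
  measurable_fun setT g -> measurable_fun setT (fun v => g (tcons (x, v))).
Proof.
move=> mg; apply: (measurableT_comp mg).
apply: (measurableT_comp (@measurable_tcons R n)) => //.
Qed.

Lemma measurable_tcons_integral n (g : n.+1.-tuple R -> \bar R) :
    measurable_fun setT g -> (forall v, 0 <= g v) ->
  measurable_fun setT (fun x => \int[mu n]_v g (tcons (x, v))).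
Proof.
move=> mg g0.
apply: (@measurable_fun_fubini_tonelli_F _ _ _ _ _ _ (g \o @tcons R n)).
  by apply: measurableT_comp => //; exact: measurable_tcons.
by move=> z; exact: g0.
Qed.

(** Induction on n, integrating out the first coordinate by Tonelli; only one of the two functions
    can see that coordinate. *)
Lemma integral_indep n (S : pred 'I_n) (g h : n.-tuple R -> \bar R) :
    measurable_fun setT g -> measurable_fun setT h ->
    (forall v, 0 <= g v) -> (forall v, 0 <= h v) ->
    depends_on S g -> depends_on (predC S) h ->
  \int[mu n]_v (g v * h v) = (\int[mu n]_v g v) * (\int[mu n]_v h v).
Proof.
elim: n S g h => [|n IH] S g h mg mh g0 h0 Sg Sh.
  rewrite /= !integral_dirac ?diracT ?mul1e//; exact: emeasurable_funM.
(* Swapping g and h together with S and its complement, the first coordinate may be given to g; the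
   inner integral of h is then a constant H. *)
wlog S0 : S g h mg mh g0 h0 Sg Sh / S ord0.
  move=> wl; case S0 : (S ord0); first exact: (wl S).
  rewrite muleC -(wl (predC S) h g)//=; last 2 first.
  - by move=> v w vw; apply: Sg => i Si; apply: vw; rewrite /= Si.
  - by rewrite S0.
  by apply: eq_integral => v _; rewrite muleC.
have ind (U : Type) (T : pred 'I_n.+1) (k : _ -> U) x : depends_on T k ->
    depends_on (fun i => T (lift ord0 i)) (fun v => k (tcons (x, v))).
  move=> Tk v w vw; apply: Tk => i; case: (unliftP ord0 i) => [j ->|->] Tj.
    by rewrite !tnthS vw.
  by rewrite !tnth0.
have hc x v : h (tcons (x, v)) = h (tcons (0%R, v)).
  apply: Sh => i; case: (unliftP ord0 i) => [j ->|->]; first by rewrite !tnthS.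
  by rewrite /= S0.
rewrite !integral_tcons//; first last.
- by move=> v; exact: mule_ge0.
- exact: emeasurable_funM.
pose H := \int[mu n]_v h (tcons (0%R, v)).
have HE x : \int[mu n]_v h (tcons (x, v)) = H by apply: eq_integral => v _.
have H0 : 0 <= H by exact: integral_ge0.
clearbody H.
transitivity (\int[uniform01 R]_x ((\int[mu n]_v g (tcons (x, v))) * H)).
  apply: eq_integral => x _; rewrite -(HE x).
  apply: (IH (fun i => S (lift ord0 i))) => //.
  - exact: measurable_tcons_section.
  - exact: measurable_tcons_section.
  - exact: ind.
  - exact: (ind _ (predC S)).
rewrite ge0_integralZr//.
- congr (_ * _); under eq_integral do rewrite HE.
  exact/esym/(integral_probability_cst (uniform01 R)).
- exact: measurable_tcons_integral.
- by move=> x _; exact: integral_ge0.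
Qed.

Lemma depends_on_select U m n (s : 'I_m -> 'I_n) (g : m.-tuple R -> U) :
  depends_on (fun j => j \in codom s) (g \o select s).
Proof.
move=> v w vw /=; congr g; apply: eq_from_tnth => i.
by rewrite !tnth_mktuple vw ?codom_f.
Qed.

(** Selections with disjoint ranges are independent: split off one factor at a time by
    [integral_indep], with the range of [s j] as the set of coordinates. *)
Lemma integral_prod_select k n (J : eqType) (js : seq J) (s : J -> 'I_k -> 'I_n)
    (g : k.-tuple R -> R) :
    measurable_fun setT g -> (forall v, (0 <= g v)%R) -> uniq js ->
    (forall j j' i i', s j i = s j' i' -> (j, i) = (j', i')) ->
  \int[mu n]_v (\prod_(j <- js) g (select (s j) v))%:E =
  (\int[mu k]_v (g v)%:E) ^+ size js.
Proof.
move=> mg g0 + sI; have mgs j : measurable_fun setT (g \o select (s j)).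
  by apply: measurableT_comp => //; exact: measurable_select.
elim: js => [_|j js IH]; last rewrite cons_uniq => /andP[jjs ujs].
  under eq_integral do rewrite big_nil.
  exact: (integral_probability_cst (mu n)).
under eq_integral do rewrite big_cons EFinM.
rewrite (@integral_indep n (fun i => i \in codom (s j))
  (fun v => (g (select (s j) v))%:E)).
- rewrite (IH ujs) expeS; congr (_ * _).
  apply: (@integral_select R k n (s j) (EFin \o g)).
  + by move=> i i' /sI[].
  + exact/measurable_EFinP.
  + by move=> v; rewrite lee_fin.
- by apply/measurable_EFinP; exact: (mgs j).
- by apply/measurable_EFinP/measurable_prod => i _; exact: mgs.
- by move=> v; rewrite lee_fin.
- by move=> v; rewrite lee_fin prodr_ge0.
- exact: (@depends_on_select _ _ _ _ (EFin \o g)).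
(* The remaining factors only read ranges of other indices, which avoid the range of [s j] because j
   does not occur in js. *)
- move=> v w vw; congr EFin; apply: eq_big_seq => j' j'js.
  apply: depends_on_select => i /codomP[i' ->]; apply: vw => /=.
  by apply/codomP => -[i'' /sI[jj' _]]; move: jjs; rewrite -jj' j'js.
Qed.

End uniform_tuple_independence.

(** * Exponential inequalities *)

Lemma expR_le_quadratic (R : realType) (z : R) :
  z <= 1 / 2 -> expR z <= 1 + z + 2 * z ^+ 2.
Proof.
move=> z2; have := expR_ge1Dx (- z); have := expR_gt0 z; have := expRxMexpNx_1 z.
move: (expR z) (expR (- z)) => a b ab1 a0 hb.
have q0 : 0 <= 1 + z + 2 * z ^+ 2 by nra.
(* The product equals 1 + z^2 (1 - 2 z). Multiplying by exp z and bounding 1 - z by exp (- z) gives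
   the claim. *)
have h : 1 <= (1 + z + 2 * z ^+ 2) * (1 - z).
  have : 0 <= z ^+ 2 * (1 - 2 * z) by rewrite mulr_ge0 ?sqr_ge0//; lra.
  nra.
rewrite -[leLHS]mulr1; apply: (le_trans (ler_wpM2l (ltW a0) h)).
have := ler_wpM2l q0 (ler_wpM2l (ltW a0) hb).
by rewrite ab1 mulr1 [X in X <= _]mulrCA.
Qed.

(** In the quadratic bound on exp the linear terms cancel, the variable being centred, and its
    variance t (1 - t) is at most 1/4. *)
Lemma bernoulli_mgf (R : realType) (t l : R) : 0 <= t <= 1 -> `|l| <= 1 / 2 ->
  (1 - t) * expR (l * (0 - t)) + t * expR (l * (1 - t)) <= expR (l ^+ 2 / 2).
Proof.
move=> /andP[t0 t1]; rewrite ler_norml => /andP[l1 l2].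
have h0 : l * (0 - t) <= 1 / 2 by nra.
have h1 : l * (1 - t) <= 1 / 2 by nra.
apply: le_trans (expR_ge1Dx _).
have /(ler_wpM2l t0) b1 := expR_le_quadratic h1.
have t1' : 0 <= 1 - t by rewrite subr_ge0.
have /(ler_wpM2l t1') b0 := expR_le_quadratic h0.
apply: (le_trans (lerD b0 b1)).
have -> : (1 - t) * (1 + l * (0 - t) + 2 * (l * (0 - t)) ^+ 2) +
  t * (1 + l * (1 - t) + 2 * (l * (1 - t)) ^+ 2) =
  1 + l ^+ 2 * (2 * (t * (1 - t))) by ring.
rewrite lerD2l; apply: ler_wpM2l; first exact: sqr_ge0.
have := sqr_ge0 (t - 1 / 2); nra.
Qed.

(** Jensen's inequality, from the tangent line of exp at the mean [A]: the deviations from [A] sum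
    to zero. *)
Lemma expR_mean_le (R : realType) (I : finType) (x : I -> R) : (0 < #|I|)%N ->
  expR ((\sum_i x i) / #|I|%:R) <= (\sum_i expR (x i)) / #|I|%:R.
Proof.
move=> I0; set A := _ / _; have c0 : 0 < #|I|%:R :> R by rewrite ltr0n.
rewrite ler_pdivlMr//.
have -> : expR A * #|I|%:R = \sum_i (expR A * (1 + (x i - A))).
  rewrite -mulr_sumr; congr (_ * _).
  rewrite big_split/= sumrB !sumr_const -mulr_natr -[A *+ _]mulr_natr.
  rewrite mulfVK ?gt_eqF//.
  by rewrite subrr addr0 mul1r.
apply: ler_sum => i _.
rewrite -[x i in leRHS](subrKC A) expRD.
by apply: ler_wpM2l; rewrite ?expR_ge0// expR_ge1Dx.
Qed.

(** * Counting injections and averaging over permutations *)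

Lemma ffact_ratio_ge (R : realType) (n k : nat) : (0 < n)%N ->
  1 - (n ^_ k)%:R / n%:R ^+ k <= k%:R ^+ 2 / (2 * n%:R) :> R.
Proof.
move=> n0; have nR : 0 < n%:R :> R by rewrite ltr0n.
have r1 j : (n ^_ j)%:R / n%:R ^+ j <= 1 :> R.
  rewrite ler_pdivrMr ?exprn_gt0// mul1r -natrX ler_nat.
  by elim: j => // j IH; rewrite ffactnSr expnSr leq_mul// leq_subr.
elim: k => [|k IHk]; first by rewrite ffactn0 expr0 divr1 subrr expr0n mul0r.
have r0 : 0 <= (n ^_ k)%:R / n%:R ^+ k :> R by rewrite divr_ge0// exprn_ge0.
have -> : (n ^_ k.+1)%:R / n%:R ^+ k.+1 =
    (n ^_ k)%:R / n%:R ^+ k * ((n - k)%N%:R / n%:R) :> R.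
  by rewrite ffactnSr natrM exprSr invfM mulrACA.
have rk := r1 k; move: IHk rk r0; set r := (n ^_ k)%:R / _ => IHk rk r0.
(* The natural subtraction is truncated: for k > n the right side is 0 and the left side
   negative. *)
have hq : 1 - k%:R / n%:R <= (n - k)%N%:R / n%:R :> R.
  rewrite -[X in X - _](@mulfV _ n%:R) ?gt_eqF// -mulrBl ler_pM2r ?invr_gt0//.
  have [kn|kn] := leqP k n; first by rewrite natrB.
  by rewrite (le_trans _ (ler0n _ _))// subr_le0 ler_nat ltnW.
have := ler_wpM2l r0 hq; rewrite mulrBr mulr1 => h.
have kn0 : 0 <= k%:R / n%:R :> R by rewrite divr_ge0.
have := ler_wpM2r kn0 rk; rewrite mul1r => h'.
have -> : k.+1%:R ^+ 2 / (2 * n%:R) =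
    k%:R ^+ 2 / (2 * n%:R) + k%:R / n%:R + 1 / (2 * n%:R) :> R.
  by rewrite -natr1; field; rewrite gt_eqF.
have : 0 <= 1 / (2 * n%:R) :> R by rewrite divr_ge0// mulr_ge0.
lra.
Qed.

(** [ext a] and [ext b] enumerate all of T, beginning with the values of a and of b in the order of
    [enum V]; p sends each entry of the first list to the entry of the second at the same
    position. *)
Lemma inj_perm_extend (V T : finType) (a b : V -> T) :
  injective a -> injective b -> exists p : {perm T}, forall v, p (a v) = b v.
Proof.
move=> aI bI; have [v0|V0] := pickP V; last by exists 1%g => v; have := V0 v.
pose ext (c : V -> T) := codom c ++ enum [predC codom c].
have ext_uniq c : injective c -> uniq (ext c).
  move=> cI; rewrite cat_uniq enum_uniq andbT; apply/andP; split.
    exact/injectiveP.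
  by apply/hasPn => x; rewrite mem_enum.
have ext_mem c x : x \in ext c by rewrite mem_cat mem_enum inE orbN.
have ext_size c : injective c -> size (ext c) = #|T|.
  move=> cI; rewrite cardE; apply/perm_size/uniq_perm.
  - exact: ext_uniq.
  - exact: enum_uniq.
  - by move=> x; rewrite ext_mem mem_enum.
pose f x := nth (b v0) (ext b) (index x (ext a)).
have fI : injective f.
  move=> x y /eqP; rewrite nth_uniq ?ext_uniq ?ext_size//; last 2 first.
  - by rewrite -(ext_size a)// index_mem.
  - by rewrite -(ext_size a)// index_mem.
  by move=> /eqP/(congr1 (nth x (ext a))); rewrite !nth_index.
exists (perm fI) => v; rewrite permE /f index_cat codom_f.
have -> : index (a v) (codom a) = index v (enum V) by rewrite index_map.
rewrite nth_cat size_codom cardE index_mem mem_enum.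
by rewrite (nth_map v) ?nth_index ?index_mem ?mem_enum.
Qed.

(* By inj_perm_extend the sum over p does not depend on the injection a, so it
   can be averaged over all injections. *)
Lemma sum_perm_comp (R : comNzRingType) (V T : finType) (h : {ffun V -> T} -> R)
    (a : V -> T) : injective a ->
  (\sum_(p : {perm T}) h [ffun v => p (a v)]) *
    (#|T| ^_ #|V|)%:R =
  (\sum_(b : {ffun V -> T} | injectiveb b) h b) * #|{perm T}|%:R.
Proof.
move=> aI; transitivity (\sum_(b : {ffun V -> T} | injectiveb b)
    \sum_(p : {perm T}) h [ffun v => p (b v)]).
  rewrite -card_inj_ffuns mulr_natr -sumr_const.
  apply: eq_big => [b|b]; first by rewrite inE.
  rewrite inE => /injectiveP bI; have [q qab] := inj_perm_extend aI bI.
  (* Permutations compose from left to right: q * p sends a v to p (q (a v)) = p (b v). *)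
  rewrite (reindex_inj (mulgI q)); apply: eq_bigr => p _; congr h.
  by apply/ffunP => v; rewrite !ffunE permM qab.
rewrite exchange_big/= mulr_natr -sumr_const; apply: eq_bigr => p _.
rewrite [RHS](reindex_inj (h := fun b : {ffun V -> T} => [ffun v => p (b v)])).
  apply: eq_bigl => b; apply/injectiveP/injectiveP => bI v w.
    by rewrite !ffunE => /perm_inj/bI.
  by move=> bvw; apply: bI; rewrite !ffunE bvw.
by move=> b c /ffunP bc; apply/ffunP => v; have := bc v; rewrite !ffunE => /perm_inj.
Qed.

(** * The conditional probability that a block of nodes carries the motif *)

Section block_density.
Variables (R : realType) (f : graphon R) (V : finType) (F : sgraph V).
Local Notation k := #|V|.
Local Notation mu := (uniform_tuple R).

(** A graphon is controlled only on the unit square; extension by zero gives bounds and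
    measurability everywhere, so integrals can run over all tuples. *)
Definition extend0 (x y : R) : R :=
  if (x \in `[0, 1]) && (y \in `[0, 1]) then f x y else 0.

Lemma extend0E x y : x \in `[0, 1] -> y \in `[0, 1] -> extend0 x y = f x y.
Proof. by rewrite /extend0 => -> ->. Qed.

Lemma extend0_01 x y : 0 <= extend0 x y <= 1.
Proof.
by rewrite /extend0; case: ifP => [/andP[]|_]; [exact: gfun01|rewrite lexx ler01].
Qed.

Lemma measurable_extend0 : measurable_fun setT (fun z : R * R => extend0 z.1 z.2).
Proof.
rewrite (_ : (fun z : R * R => _) = (fun z : R * R => f z.1 z.2) \_ (unit_square R)).
  apply/(measurable_restrictT _ _).1; last exact: measurable_gfun.
  exact: measurableX.
apply/funext => -[x y]; rewrite /extend0 patchE; case: ifPn => [/andP[hx hy]|].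
  by rewrite mem_set.
move=> /negP hxy; rewrite memNset//= => -[hx hy]; apply: hxy.
by apply/andP; split.
Qed.

Definition oriented_edge (e : V * V) : bool :=
  F e.1 e.2 && (enum_rank e.1 < enum_rank e.2)%N.

(** For labels x in the unit cube, the conditional probability that a given injective placement of V
    is a homomorphism. *)
Definition edge_weight (x : k.-tuple R) : R :=
  \prod_(e | oriented_edge e)
    extend0 (tnth x (enum_rank e.1)) (tnth x (enum_rank e.2)).

Lemma edge_weight01 x : 0 <= edge_weight x <= 1.
Proof.
apply/andP; split.
  by apply: prodr_ge0 => e _; have /andP[] := extend0_01
    (tnth x (enum_rank e.1)) (tnth x (enum_rank e.2)).
by apply: prodr_ile1 => e _; exact: extend0_01.
Qed.

Lemma measurable_edge_weight : measurable_fun setT edge_weight.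
Proof.
rewrite (_ : edge_weight = fun x => \prod_(e : V * V) if oriented_edge e then
    extend0 (tnth x (enum_rank e.1)) (tnth x (enum_rank e.2)) else 1); last first.
  by apply/funext => v; rewrite /edge_weight big_mkcond.
apply: measurable_prod => e _ /=; case: (oriented_edge e) => //.
apply: (measurableT_comp measurable_extend0
  (g := fun x => (tnth x (enum_rank e.1), tnth x (enum_rank e.2)))).
by apply: measurable_fun_pair; exact: measurable_tnth.
Qed.

Lemma integral_unit_cube n (g : n.-tuple R -> \bar R) :
  measurable_fun setT g -> (forall v, 0 <= g v)%E ->
  (\int[mu n]_(v in unit_cube R n) g v = \int[mu n]_v g v)%E.
Proof.
move=> mg g0; have mC : measurable (unit_cube R n) by exact: measurable_unit_cube.
rewrite [RHS](@ge0_negligible_integral _ _ _ _ setT (~` unit_cube R n))//.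
- by rewrite setDE setCK setTI.
- exact: measurableC.
- transitivity (1 - mu n (unit_cube R n))%E; first exact: probability_setC.
  by rewrite uniform_tuple_cube subee.
Qed.

Lemma graphon_densityE :
  (graphon_density F f)%:E = (\int[mu k]_v (edge_weight v)%:E)%E.
Proof.
have w0 v : (0 <= (edge_weight v)%:E)%E.
  by rewrite lee_fin; have /andP[] := edge_weight01 v.
have mw : measurable_fun setT (EFin \o edge_weight).
  by apply/measurable_EFinP; exact: measurable_edge_weight.
rewrite /graphon_density /Rintegral.
under eq_integral => v /[1!inE] cv.
  rewrite (_ : \prod_(_ | _) _ = edge_weight v); last first.
    by apply: eq_bigr => e _; rewrite extend0E//; exact: cv.
  over.
(* The real-valued integral is [fine] of the extended one, so finiteness must be checked; the total
   mass 1 bounds it. *)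
rewrite integral_unit_cube// fineK// ge0_fin_numE; last exact: integral_ge0.
apply: (@le_lt_trans _ _ 1%E); last exact: ltry.
rewrite -[leRHS](integral_probability_cst (mu k)); apply: ge0_le_integral => //.
by move=> v _; rewrite lee_fin; have /andP[] := edge_weight01 v.
Qed.

Lemma integral_edge_weight_affine a b :
  (\int[mu k]_v ((1 - edge_weight v) * a + edge_weight v * b)%:E =
   ((1 - graphon_density F f) * a + graphon_density F f * b)%:E)%E.
Proof.
have iw : (mu k).-integrable setT (EFin \o edge_weight).
  apply: measurable_bounded_integrable => //.
  - by apply: le_lt_trans (ltry 1); exact: probability_le1.
  - exact: measurable_edge_weight.
  - exists 1; split=> // M M1 v _ /=; have /andP[w0 w1] := edge_weight01 v.
    by rewrite ger0_norm// (le_trans w1)// ltW.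
have -> : (fun v => ((1 - edge_weight v) * a + edge_weight v * b)%:E) =
    (fun v => a%:E + (b - a)%:E * (EFin \o edge_weight) v)%E.
  by apply/funext => v /=; rewrite -EFinM -EFinD; congr EFin; ring.
rewrite integralD//; last exact: integrableZl.
  rewrite integral_probability_cst integralZl// -graphon_densityE -EFinM -EFinD.
  by congr EFin; ring.
by apply: finite_measure_integrable_cst.
Qed.

Lemma graphon_density01 : 0 <= graphon_density F f <= 1.
Proof.
apply/andP; split; rewrite -lee_fin graphon_densityE.
  by apply: integral_ge0 => v _; rewrite lee_fin; have /andP[] := edge_weight01 v.
rewrite -[leRHS](integral_probability_cst (mu k)); apply: ge0_le_integral => //.
- by move=> v _; rewrite lee_fin; have /andP[] := edge_weight01 v.
- by apply/measurable_EFinP; exact: measurable_edge_weight.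
- by move=> v _; rewrite lee_fin; have /andP[] := edge_weight01 v.
Qed.

(** By symmetry of both graphs one orientation per edge suffices, so each edge yields one factor, as
    independence of the coins requires. *)
Lemma hom_indicatorE (T : finType) (G : sgraph T) (b : V -> T) :
  ([ffun u => b u] \in homs F G)%:R =
  \prod_(e | oriented_edge e) (G (b e.1) (b e.2))%:R :> R.
Proof.
rewrite inE; case: forallP => h.
  rewrite big1// => -[u w] /andP[/= uw _].
  by have /forallP/(_ w) := h u; rewrite uw !ffunE => /= ->.
apply/esym/eqP/prodf_eq0.
have : [exists u, [exists w, F u w && ~~ G (b u) (b w)]].
  apply: contra_notT h => /existsPn h u; apply/forallP => w; rewrite !ffunE.
  by have /existsPn/(_ w) := h u; rewrite negb_and negbK implybE.
move=> /existsP[u /existsP[w /andP[uw Guw]]].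
have uNw : enum_rank u != enum_rank w.
  by apply: contraTneq uw => /enum_rank_inj ->; rewrite adj_irr.
have [uw_lt|uw_ge] := ltnP (enum_rank u) (enum_rank w).
  by exists (u, w); rewrite /oriented_edge/= ?uw// (negbTE Guw).
exists (w, u); last by rewrite /= adj_sym (negbTE Guw).
by rewrite /oriented_edge/= adj_sym uw/= ltn_neqAle eq_sym uNw.
Qed.

End block_density.

(** * Chernoff's bound for the density of injective homomorphisms *)

Section tail.
Variables (R : realType) (n : nat) (f : graphon R) (V : finType) (F : sgraph V).
Local Notation k := #|V|.
Local Notation mu := (uniform_tuple R).
Local Notation t := (graphon_density F f).

Section blocks.
Variables (m : nat) (s : 'I_m -> V -> 'I_n).
Hypothesis sI : forall j j' u u', s j u = s j' u' -> (j, u) = (j', u').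

(** Labels are tuples indexed by ['I_k], whereas placements are indexed by V; the enumeration of V
    translates. *)
Definition block j (i : 'I_k) : 'I_n := s j (enum_val i).

(** Given the labels, disjoint blocks succeed independently. Write each factor as X (b - a) + a and
    expand over the set J of blocks contributing X; the blocks of J all succeed with the product
    probability, and the expansion folds back. *)
Lemma sum_edge_pmf_blocks (v : n.-tuple R) (a b : R) : unit_cube R n v ->
  \sum_g edge_pmf f v g *
    \prod_(j < m) (if [ffun u => s j u] \in homs F g then b else a) =
  \prod_(j < m) ((1 - edge_weight f F (select (block j) v)) * a +
                 edge_weight f F (select (block j) v) * b).
Proof.
move=> cv; set w := fun j => edge_weight f F (select (block j) v).
have split_in (J : {set 'I_m}) (z : 'I_m -> R) :
    \prod_j (if j \in J then z j * (b - a) else a) =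
    (\prod_(j in J) z j) * \prod_j (if j \in J then b - a else a).
  rewrite [X in X * _]big_mkcond -big_split/=; apply: eq_bigr => j _.
  by case: ifP => _; rewrite ?mul1r.
pose X g j : R := ([ffun u => s j u] \in homs F g)%:R.
transitivity (\sum_(J : {set 'I_m})
    (\sum_g edge_pmf f v g * \prod_(j in J) X g j) *
    \prod_j (if j \in J then b - a else a)).
  under [RHS]eq_bigr do rewrite mulr_suml.
  rewrite exchange_big/=; apply: eq_bigr => g _.
  transitivity (edge_pmf f v g * \prod_j (X g j * (b - a) + a)).
    congr (_ * _); apply: eq_bigr => j _; rewrite /X.
    by case: ifP => _; rewrite ?mul1r ?subrK// mul0r add0r.
  rewrite bigA_distr mulr_sumr; apply: eq_bigr => J _.
  by rewrite split_in mulrA.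
transitivity (\prod_j (w j * (b - a) + a)); last first.
  by apply: eq_bigr => j _; rewrite -/(w j); ring.
rewrite bigA_distr; apply: eq_bigr => J _; rewrite split_in; congr (_ * _).
pose P (p : 'I_m * (V * V)) := (p.1 \in J) && oriented_edge F p.2.
transitivity (\prod_(p | P p)
    f (tnth v (s p.1 p.2.1)) (tnth v (s p.1 p.2.2))); last first.
  rewrite -(pair_big (mem J) (oriented_edge F)
    (fun j e => f (tnth v (s j e.1)) (tnth v (s j e.2))))/=.
  apply: eq_bigr => j _; apply: eq_bigr => e _; rewrite !tnth_mktuple /block.
  by rewrite !enum_rankK extend0E//; exact: cv.
rewrite -(@sum_edge_pmf_subgraph _ _ _ _ cv _ P (fun p => s p.1 p.2.1)
  (fun p => s p.1 p.2.2)).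
- apply: eq_bigr => g _; congr (_ * _).
  rewrite -(pair_big (mem J) (oriented_edge F)
    (fun j e => (g (s j e.1) (s j e.2))%:R : R))/=.
  by apply: eq_bigr => j _; rewrite /X hom_indicatorE.
- move=> [j [u u']] /andP[_ /andP[/= uu' _]]; apply: contraTneq uu' => /sI[->].
  by rewrite adj_irr.
(* Equal pairs lie in the same block and come from the same edge; a reversed match is impossible,
   both orientations being increasing. *)
- move=> [j [u u']] [j' [w1 w2]] /andP[_ /andP[/= _ uu']] /andP[_ /andP[/= _ ww']].
  case=> -[/sI[-> e1] /sI[e2]]; first by rewrite e1 e2.
  by move: uu' ww'; rewrite e1 e2 ltnNge => /negP + /ltnW.
Qed.

(** After conditioning, the factors read disjoint sets of labels, so they are independent too and
    the mean is an m-th power. *)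
Lemma integral_sum_edge_pmf_blocks (a b : R) : 0 <= a -> 0 <= b ->
  (\int[mu n]_(v in unit_cube R n)
    (\sum_g edge_pmf f v g *
      \prod_(j < m) (if [ffun u => s j u] \in homs F g then b else a))%:E =
  (((1 - t) * a + t * b) ^+ m)%:E)%E.
Proof.
move=> a0 b0; pose h x := (1 - edge_weight f F x) * a + edge_weight f F x * b.
have h0 x : 0 <= h x.
  have /andP[w0 w1] := edge_weight01 f F x.
  by rewrite addr_ge0// mulr_ge0// subr_ge0.
have mh : measurable_fun setT h.
  have mw := measurable_edge_weight f F.
  by apply: measurable_funD; apply: measurable_funM => //; exact: measurable_funB.
under eq_integral => v /[1!inE] cv do rewrite sum_edge_pmf_blocks//.
rewrite integral_unit_cube.
- rewrite (integral_prod_select (js := index_enum 'I_m) mh h0).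
  + rewrite integral_edge_weight_affine -EFin_expe; congr (_ ^+ _)%:E.
    by rewrite /index_enum -enumT size_enum_ord.
  + exact: index_enum_uniq.
  + by move=> j j' i i' /sI[-> /enum_val_inj ->].
- apply/measurable_EFinP/measurable_prod => j _.
  by apply: (measurableT_comp mh); exact: measurable_select.
- by move=> v; rewrite lee_fin prodr_ge0// => j _; exact: h0.
Qed.

End blocks.

Lemma measurable_edge_pmf g : measurable_fun (unit_cube R n) (edge_pmf f ^~ g).
Proof.
apply: (@eq_measurable_fun _ _ _ _ _ (fun v => \prod_(e : 'I_n * 'I_n)
    if (e.1 < e.2)%N then
      bernoulli_pmf (extend0 f (tnth v e.1) (tnth v e.2)) (g e.1 e.2) else 1)).
  move=> v /[1!inE] cv; rewrite /edge_pmf [RHS]big_mkcond; apply: eq_bigr => e _.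
  by case: ifP => // _; rewrite extend0E//; exact: cv.
apply: measurable_funTS; apply: measurable_prod => -[i j] _ /=.
case: (i < j)%N => //.
have mf : measurable_fun setT
    (fun v : n.-tuple R => extend0 f (tnth v i) (tnth v j)).
  apply: (measurableT_comp (measurable_extend0 f)
    (g := fun v => (tnth v i, tnth v j))).
  by apply: measurable_fun_pair; exact: measurable_tnth.
by rewrite /bernoulli_pmf; case: (g i j) => //; exact: measurable_funB.
Qed.

Definition inj_density (G : sgraph 'I_n) : R :=
  (\sum_(b : {ffun V -> 'I_n} | injectiveb b) (b \in homs F G)%:R) /
  (n ^_ k)%:R.

(** The sign of l selects the tail: the event says Y - t >= l for l > 0 and Y - t <= l for l < 0.
    Using l both as threshold and as exponent per block leaves exp (- m l^2) * exp (l^2 / 2)^m. *)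
Lemma inj_density_tail (m : nat) (l : R) :
    (0 < m)%N -> (m * k <= n)%N -> `|l| <= 1 / 2 ->
  (random_graph n f [set G | (l ^+ 2 <= l * (inj_density G - t))%R] <=
   (expR (- (m%:R * l ^+ 2 / 2)))%:E)%E.
Proof.
move=> m0 mk l12.
have k0 : (k <= n)%N by rewrite (leq_trans _ mk)// leq_pmull.
have sN j (u : V) : (j < m)%N -> (j * k + enum_rank u < n)%N.
  move=> jm; apply: leq_trans mk; apply: (@leq_trans (j.+1 * k)).
    by rewrite mulSn addnC ltn_add2r.
  by rewrite leq_mul2r jm orbT.
pose s (j : 'I_m) (u : V) : 'I_n := Ordinal (sN j u (ltn_ord j)).
(* Blocks are consecutive intervals of length k: quotient and remainder by k recover j and the rank
   of u. *)
have sI j j' u u' : s j u = s j' u' -> (j, u) = (j', u').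
  move=> /(congr1 val)/= e; have k_gt0 : (0 < k)%N by apply/card_gt0P; exists u.
  have := congr1 (divn^~ k) e.
  rewrite !divnMDl// !divn_small// !addn0 => /val_inj ->.
  have := congr1 (modn^~ k) e.
  by rewrite !modnMDl !modn_small// => /val_inj/enum_rank_inj ->.
pose a := expR (l * (0 - t)); pose b := expR (l * (1 - t)).
pose N : R := #|{perm 'I_n}|%:R.
have N0 : (0 < #|{perm 'I_n}|)%N by apply/card_gt0P; exists 1%g.
have NR : 0 < N by rewrite ltr0n.
pose sp (p : {perm 'I_n}) j u := p (s j u).
have spI p j j' u u' : sp p j u = sp p j' u' -> (j, u) = (j', u').
  by move=> /perm_inj/sI.
pose X (p : {perm 'I_n}) (j : 'I_m) g : R := ([ffun u => sp p j u] \in homs F g)%:R.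
pose Z p g := \prod_(j < m) (if [ffun u => sp p j u] \in homs F g then b else a).
have Z0 p g : 0 <= Z p g.
  by apply: prodr_ge0 => j _; case: ifP => _; exact: expR_ge0.
(* Markov's constant: the threshold m l^2 in the exponent, and 1 / N for the average over
   permutations. *)
pose c := expR (- (m%:R * l ^+ 2)) / N.
have c0 : 0 <= c by rewrite divr_ge0 ?expR_ge0// ltW.
(* For each block j, averaging its indicator over all permutations gives [inj_density], by
   [sum_perm_comp]. *)
have mY g : m%:R * (l * (inj_density g - t)) =
    (\sum_p \sum_(j < m) l * (X p j g - t)) / N.
  rewrite exchange_big/=.
  rewrite (eq_bigr (fun=> l * (inj_density g - t) * N)).
    by rewrite sumr_const card_ord -[_ *+ m]mulr_natl; field; rewrite gt_eqF.
  move=> j _; rewrite -mulr_sumr -mulrA; congr (_ * _).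
  rewrite sumrB sumr_const -[t *+ _]mulr_natr -/N mulrBl; congr (_ - _).
  have := @sum_perm_comp R V 'I_n (fun b => (b \in homs F g)%:R) (s j).
  rewrite card_ord => /(_ (fun u u' e => congr1 snd (sI _ _ _ _ e))) h.
  apply: (@mulIf _ (n ^_ k)%:R); first by rewrite pnatr_eq0 -lt0n ffact_gt0.
  by rewrite h -/N /inj_density mulrAC divfK// pnatr_eq0 -lt0n ffact_gt0.
(* Markov's inequality in pointwise form, with Jensen taking the average over p out of the
   exponential. *)
have key g : l ^+ 2 <= l * (inj_density g - t) -> 1 <= c * \sum_p Z p g.
  move=> lg; have : 1 <= expR (m%:R * (l * (inj_density g - t)) - m%:R * l ^+ 2).
    by rewrite -expR0 ler_expR subr_ge0 ler_wpM2l.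
  move=> /le_trans; apply; rewrite expRD mulrC /c -mulrA; apply: ler_wpM2l.
    exact: expR_ge0.
  rewrite mY (le_trans (expR_mean_le _ N0))// mulrC; apply: ler_wpM2l.
    by rewrite invr_ge0 ltW.
  apply: ler_sum => p _; rewrite expR_sum; apply: ler_prod => j _.
  by rewrite expR_ge0/= /X; case: ifP.
set A := [set G | _].
have pmf0 v g : unit_cube R n v -> 0 <= edge_pmf f v g by move=> /edge_pmf_ge0.
have mZ p : measurable_fun (unit_cube R n)
    (fun v => (\sum_g edge_pmf f v g * Z p g)%:E).
  apply/measurable_EFinP/measurable_sum => g; apply: measurable_funM => //.
  exact: measurable_edge_pmf.
have mZ0 p v : unit_cube R n v -> (0 <= (\sum_g edge_pmf f v g * Z p g)%:E)%E.
  by move=> cv; rewrite lee_fin sumr_ge0// => g _; rewrite mulr_ge0// pmf0.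
have mC : measurable (unit_cube R n) by exact: measurable_unit_cube.
apply: (@le_trans _ _ (\int[mu n]_(v in unit_cube R n)
    (c%:E * \sum_p (\sum_g edge_pmf f v g * Z p g)%:E))%E).
  apply: ge0_le_integral => //.
  - by move=> v cv; rewrite lee_fin sumr_ge0// => g _; exact: pmf0.
  - apply/measurable_EFinP.
    rewrite (_ : (fun v => _) =
        fun v => \sum_g if g \in A then edge_pmf f v g else 0).
      apply: measurable_sum => g; case: (g \in A) => //.
      exact: measurable_edge_pmf.
    by apply/funext => v; rewrite big_mkcond.
  - by apply: measurable_funeM; apply: emeasurable_sum => p; exact: mZ.
  - move=> v cv; rewrite sumEFin -EFinM lee_fin exchange_big mulr_sumr big_mkcond/=.
    apply: ler_sum => g _; rewrite -mulr_sumr mulrCA.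
    case: ifPn => [/[1!inE] /key h|_]; first by rewrite ler_peMr// pmf0.
    by rewrite mulr_ge0 ?pmf0// mulr_ge0// sumr_ge0.
rewrite ge0_integralZl_EFin//; last 2 first.
- by move=> v cv; apply: sume_ge0 => p _; exact: mZ0.
- by apply: emeasurable_sum => p; exact: mZ.
rewrite ge0_integral_sum//.
under eq_bigr do rewrite (integral_sum_edge_pmf_blocks (@spI _)) ?expR_ge0//.
rewrite sumEFin -EFinM lee_fin sumr_const -[_ *+ _]mulr_natr -/N /c.
rewrite mulrACA mulVf ?gt_eqF// mulr1.
have -> : - (m%:R * l ^+ 2 / 2) = - (m%:R * l ^+ 2) + m%:R * (l ^+ 2 / 2) :> R.
  by field.
rewrite expRD; apply: ler_wpM2l; first exact: expR_ge0.
have /andP[t0 t1] := graphon_density01 f F.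
rewrite expRM_natl; apply: lerXn2r; rewrite ?nnegrE ?expR_ge0//.
  by rewrite addr_ge0 ?mulr_ge0 ?expR_ge0 ?subr_ge0.
by apply: bernoulli_mgf => //; rewrite t0.
Qed.

(** With x injective and y other homomorphisms, N = n^k and M the number of injections, the
    difference is y / N - (x / M) (1 - M / N). Both terms lie between 0 and 1 - M / N, so no factor
    2 is lost. *)
Lemma inj_density_approx (G : sgraph 'I_n) : (0 < n)%N -> (k <= n)%N ->
  `|hom_density R F G - inj_density G| <= k%:R ^+ 2 / (2 * n%:R).
Proof.
move=> n0 kn; apply: le_trans (ffact_ratio_ge R k n0).
have N0 : 0 < n%:R ^+ k :> R by rewrite exprn_gt0// ltr0n.
have M0 : 0 < (n ^_ k)%:R :> R by rewrite ltr0n ffact_gt0.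
pose I : {set {ffun V -> 'I_n}} := [set b : {ffun V -> 'I_n} | injectiveb b]%SET.
pose x := #|homs F G :&: I|; pose y := #|homs F G :\: I|.
have cI : #|I| = (n ^_ k)%N by rewrite card_inj_ffuns card_ord.
have cH : #|homs F G| = (x + y)%N by rewrite -(cardsID I).
have xM : (x <= n ^_ k)%N by rewrite -cI subset_leq_card// subsetIr.
have yM : (n ^_ k + y <= n ^ k)%N.
  rewrite -cI -cardsUI (_ : I :&: _ = finset.set0).
    rewrite cards0 addn0 (leq_trans (max_card _))// card_ffun card_ord//.
  by apply/setP => b; rewrite !inE; case: (injectiveb b); rewrite ?andbF.
rewrite /hom_density /inj_density card_ord cH.
have -> : \sum_(b : {ffun V -> 'I_n} | injectiveb b) (b \in homs F G)%:R = x%:R :> R.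
  rewrite -natr_sum /x -sum1_card; congr _%:R.
  rewrite [RHS](eq_bigl (fun b : {ffun V -> 'I_n} =>
      injectiveb b && (b \in homs F G))).
    by rewrite big_mkcondr.
  by move=> b; rewrite !inE andbC.
move: xM yM; rewrite -(ler_nat R) -[(_ + _ <= _)%N](ler_nat R) !natrD natrX.
move: N0 M0; move: (n%:R ^+ k) ((n ^_ k)%:R : R).
move: (x%:R : R) (y%:R : R) (ler0n R x) (ler0n R y).
clear cH; clearbody x y; move=> {}x {}y x0 y0 N M N0 M0 xM yM.
have -> : (x + y) / N - x / M = y / N - x / M * (1 - M / N).
  by field; rewrite !gt_eqF.
have hy : y / N <= 1 - M / N.
  by rewrite lerBrDr -mulrDl ler_pdivrMr// mul1r addrC.
have y0' : 0 <= y / N by rewrite divr_ge0// ltW.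
have x1 : x / M <= 1 by rewrite ler_pdivrMr// mul1r.
have x0' : 0 <= x / M by rewrite divr_ge0// ltW.
rewrite ler_norml; apply/andP; split; nra.
Qed.

End tail.

(** * From injective densities to the concentration inequality *)

Theorem theorem5p3 (R : realType) (k : nat) (B : 'I_k -> graphon R)
    (alpha : 'I_k -> R) (alpha_ge0 : forall i, 0 <= alpha i)
    (alpha_sum : \sum_(i < k) alpha i = 1)
    (n : nat) (n_ge1 : (1 <= n)%N)
    (V : finType) (V_gt0 : (0 < #|V|)%N) (F : sgraph V)
    (eps : R) (eps01 : 0 <= eps <= 1) :
  let f := generator B alpha_ge0 alpha_sum in
  (random_graph n f
     [set G | (`|hom_density R F G - graphon_density F f| > eps)%R]
   <= (2 * expR (- (eps ^+ 2 * n%:R / (8 * #|V|%:R ^+ 2))))%:E)%E.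

Proof.
cbv zeta; set f := generator B _ _; have /andP[e0 e1] := eps01; set v := #|V|.
have vR : 0 < v%:R :> R by rewrite ltr0n.
have nR : 0 < n%:R :> R by rewrite ltr0n.
have v2 : 0 < v%:R ^+ 2 :> R by rewrite exprn_gt0.
set A := [set G | _].
have [env|env] := ltP (eps * n%:R) (v%:R ^+ 2).
  apply: (@le_trans _ _ 1%E); first exact: (probability_le1 (random_graph n f)).
  (* Since eps <= 1, eps^2 n <= eps n < v^2; the bound is then at least 2 (1 - 1/8) > 1. *)
  have u8 : eps ^+ 2 * n%:R / (8 * v%:R ^+ 2) <= 1 / 8.
    rewrite ler_pdivrMr ?mulr_gt0// mulrA divfK// mul1r expr2 -mulrA.
    by apply: le_trans (ltW env); rewrite ler_piMl// mulr_ge0// ltW.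
  rewrite lee_fin; have := expR_ge1Dx (- (eps ^+ 2 * n%:R / (8 * v%:R ^+ 2))).
  lra.
have vn : (v ^ 2 <= n)%N.
  by rewrite -(ler_nat R) natrX (le_trans env)// ler_piMl// ltW.
pose m := (n %/ v)%N.
have vm : (v <= m)%N by rewrite leq_divRL.
have m_gt0 : (0 < m)%N by exact: leq_trans vm.
have mv : (m * v <= n)%N by exact: leq_trunc_div.
(* This absorbs the rounding in m: n <= m v + (v - 1), and v - 1 <= m v (v - 1). *)
have nmv : (n <= m * v ^ 2)%N.
  have : (n < m.+1 * v)%N by exact: ltn_ceil.
  move: V_gt0 m_gt0; rewrite -/v; clear; nia.
have vn' : (v <= n)%N by rewrite (leq_trans _ mv)// leq_pmull.
(* Half of eps pays for passing to injective homomorphisms, the other half is the deviation left for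
   the tails. *)
pose d := eps / 2.
pose tail (l : R) := [set G : sgraph 'I_n |
  l ^+ 2 <= l * (inj_density R F G - graphon_density F f)].
have tail_le (l : R) : `|l| = d ->
    (random_graph n f (tail l) <=
      (expR (- (eps ^+ 2 * n%:R / (8 * v%:R ^+ 2))))%:E)%E.
  move=> ld; apply: le_trans (inj_density_tail f F m_gt0 mv _) _.
    by rewrite ld ler_pM2r ?invr_gt0.
  rewrite lee_fin ler_expR lerN2 -(real_normK (num_real l)) ld /d.
  rewrite ler_pdivrMr ?mulr_gt0//.
  have -> : m%:R * (eps / 2) ^+ 2 / 2 * (8 * v%:R ^+ 2) =
      eps ^+ 2 * (m * v ^ 2)%N%:R :> R by rewrite natrM natrX; field.
  by apply: ler_wpM2l; rewrite ?sqr_ge0// ler_nat.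
have d0 : 0 <= d by rewrite divr_ge0.
have A_sub : A `<=` tail d `|` tail (- d).
  move=> G; rewrite /A/= => hG; have hY := inj_density_approx R F G n_ge1 vn'.
  have hd : v%:R ^+ 2 / (2 * n%:R) <= d.
    by rewrite ler_pdivrMr ?mulr_gt0// /d mulrA divfK.
  have {}hY := le_trans hY hd.
  have : d <= `|inj_density R F G - graphon_density F f|.
    have := ler_distD (inj_density R F G) (hom_density R F G) (graphon_density F f).
    rewrite /d in hY *; lra.
  rewrite ler_normr => /orP[] h; [left|right]; rewrite /tail/= expr2.
    exact: ler_wpM2l.
  by rewrite mulrNN mulNr -mulrN; apply: ler_wpM2l.
apply: (@le_trans _ _ (random_graph n f (tail d `|` tail (- d)))).
  by apply: (le_measure (random_graph n f)); rewrite ?inE.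
apply: le_trans (measureU2 (random_graph n f) _ _) _ => //.
rewrite mulr_natl mulr2n EFinD; apply: leeD; apply: tail_le.
  by rewrite ger0_norm.
by rewrite normrN ger0_norm.
Qed.
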